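(* Let $k$ be a positive integer, $n$ a non-negative integer, and $p$ a prime with $p\equiv 3\pmod 4$. Let $\delta$ be a non-negative integer with $p\mid 4\delta+3$. Put $$N_1=p\,(4p^kn+4\delta+3),\qquad N_2=4p^{k-1}n+\frac{4\delta+3}{p}.$$ Then $\mathcal{J}_{10}(N_1)\equiv\mathcal{J}_{10}(N_2)\pmod 2$.
   Context: Let $q=e^{2\pi i\tau}$, $(a;q)_\infty=\prod_{j\ge0}(1-aq^j)$, and $\eta(\tau)=q^{1/24}(q;q)_\infty$. Define $$j_{10}(\tau)=\frac{\eta(2\tau)\eta(5\tau)^5}{\eta(\tau)\eta(10\tau)^5}-1=\frac1q+\sum_{n\ge0}\mathcal{J}_{10}(n)q^n.$$ *)

(* Defs.v *)
From HB Require Import structures.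
From mathcomp Require Import all_boot all_order all_algebra.
Set Implicit Arguments. Unset Strict Implicit. Unset Printing Implicit Defensive.
Import Order.TTheory GRing.Theory Num.Theory.
Local Open Scope ring_scope.

(* j10 + 1 = q^{-1} * F(q) with
   F(q) = (q^2;q^2)_oo (q^5;q^5)_oo^5 / ((q;q)_oo (q^10;q^10)_oo^5)
   (the q^{1/24}-powers of the eta quotient combine to q^{-1}).
   [eta_trunc m] is a polynomial whose coefficients of degree <= m agree with
   those of F: factors with j > m only affect degrees > m, and
   1/(1-q^a) is replaced by its truncation sum_{i<=m} q^{a i}. *)
Definition eta_trunc (m : nat) : {poly int} :=
  \prod_(1 <= j < m.+1)
    ( (1 - 'X^(2 * j)) * (1 - 'X^(5 * j)) ^+ 5
      * (\sum_(i < m.+1) 'X^(i * j))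
      * (\sum_(i < m.+1) 'X^(10 * i * j)) ^+ 5 ).

Definition F_coef (m : nat) : int := (eta_trunc m)`_m.

(* J10(n) = coefficient of q^n in j10 = q^{-1} F(q) - 1, for n >= 0 *)
Definition J10 (n : nat) : int := F_coef n.+1 - (n == 0%N)%:Z.

(* Main.v *)
Require Import Defs.
From mathcomp Require Import all_boot all_order all_algebra.
From mathcomp Require Import zify ring.
Set Implicit Arguments. Unset Strict Implicit. Unset Printing Implicit Defensive.
Import Order.TTheory GRing.Theory Num.Theory.
Local Open Scope ring_scope.

(* Write f_k for (q^k;q^k)_oo. Modulo 2 the eta quotient F = q (j10 + 1) is
   f_1 / f_5^5. The key congruence is f_1 f_5 = f_1^6 + q f_5^6 (mod 2): it
   turns F into q + (f_1 / f_5)^6, and used once more it gives the odd part of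
   (f_1 / f_5)^3, so that J10(4u + 1) is congruent to the coefficient of q^u in
   f_1^6 + q f_5^6. As f_1^3 is congruent to psi = sum_j q^(2j^2 + j), for
   N = 1 (mod 4) the number J10(N) mod 2 counts whether N is a square plus
   whether N is five times a square, and the theorem follows from
   N_1 = p^2 N_2.

   By the Jacobi triple product f_1 f_5 is congruent to the product of
   sum_j q^((5j^2 - 3j)/2) and sum_j q^((5j^2 - j)/2), so the key congruence
   follows from psi(q)^2 = this product + q psi(q^5)^2. The latter counts
   Gaussian integers z = a + b i with a, b odd and norm 8n + 2, up to units:
   those divisible by 2 + i correspond to norm (8n + 2) / 5, and each of the
   others has exactly one associate congruent to 1 modulo 2 + i.

   Power series truncated at q^L are represented by elements of a commutative
   ring containing an [x] with [x ^+ L = 0]. *)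

(** * Gaussian binomials and the finite Jacobi triple product *)

(** The q-Pascal rule serves as definition, so that Gaussian binomials exist in every commutative
    ring without division. *)
Fixpoint qbin (R : comNzRingType) (Q : R) (n k : nat) : R :=
  match n, k with
  | _, 0 => 1
  | 0, _.+1 => 0
  | n'.+1, k'.+1 => qbin Q n' k' + Q ^+ k * qbin Q n' k
  end.

Lemma qbinn0 (R : comNzRingType) (Q : R) n : qbin Q n 0 = 1.
Proof. by case: n. Qed.

Lemma qbinS (R : comNzRingType) (Q : R) n k :
  qbin Q n.+1 k.+1 = qbin Q n k + Q ^+ k.+1 * qbin Q n k.+1.
Proof. by []. Qed.

Lemma qbin_small (R : comNzRingType) (Q : R) n k : (n < k)%N -> qbin Q n k = 0.
Proof.
elim: n k => [|n IHn] [|k] // nk.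
by rewrite qbinS !IHn ?mulr0 ?addr0 // ltnW.
Qed.

Definition euler (R : comNzRingType) (x : R) (c n : nat) : R :=
  \prod_(1 <= i < n.+1) (1 - x ^+ (c * i)).

Lemma euler0 (R : comNzRingType) (x : R) c : euler x c 0 = 1.
Proof. by rewrite /euler big_geq. Qed.

Lemma eulerS (R : comNzRingType) (x : R) c n :
  euler x c n.+1 = euler x c n * (1 - x ^+ (c * n.+1)).
Proof. by rewrite /euler big_nat_recr. Qed.

(** The quotient formula for Gaussian binomials with denominators cleared. The induction rests on 1
    - y z = (1 - y) + y (1 - z), with y and z the powers of [x ^+ c] of exponents [i] and [j]. *)
Lemma qbin_euler (R : comNzRingType) (x : R) c i j :
  qbin (x ^+ c) (i + j) i * (euler x c i * euler x c j) = euler x c (i + j).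
Proof.
move: {2}(i + j)%N (leqnn (i + j)) => n; elim: n i j => [|n IHn] i j.
  by case: i; case: j => // _; rewrite euler0 !mulr1.
case: i => [|i]; first by rewrite add0n qbinn0 euler0 !mul1r.
case: j => [|j] ijn.
  have IH := IHn i 0%N; rewrite !addn0 in IH ijn *.
  rewrite qbinS (qbin_small _ (ltnSn i)) mulr0 addr0 euler0 mulr1.
  by rewrite eulerS mulrA -[in RHS]IH // euler0 mulr1.
have := IHn i j.+1; have := IHn i.+1 j; rewrite addSnnS.
have -> : (i.+1 + j.+1 = (i + j.+1).+1)%N by [].
move=> IH1 IH2.
rewrite qbinS mulrDl (eulerS _ _ (i + _)) -exprM.
set a := qbin _ _ i in IH2 *; set b := qbin _ _ i.+1 in IH1 *.
have -> : a * (euler x c i.+1 * euler x c j.+1)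
  = (1 - x ^+ (c * i.+1)) * euler x c (i + j.+1).
  by rewrite -IH2 ?(eulerS _ _ i); [ring | lia].
have -> : x ^+ (c * i.+1) * b * (euler x c i.+1 * euler x c j.+1)
  = x ^+ (c * i.+1) * (1 - x ^+ (c * j.+1)) * euler x c (i + j.+1).
  by rewrite -IH1 ?(eulerS _ _ j); [ring | lia].
have -> : (c * (i + j.+1).+1 = c * i.+1 + c * j.+1)%N by lia.
by rewrite exprD; ring.
Qed.

(* With the integer j = k - M this is r j(j+1)/2 + s j(j-1)/2: since truncated
   subtraction kills k - M or M - k, two of the four binomials vanish. *)
Definition theta_exp (r s M k : nat) : nat :=
  r * ('C((k - M).+1, 2) + 'C(M - k, 2))
  + s * ('C(k - M, 2) + 'C((M - k).+1, 2)).

Lemma binS2 n : 'C(n.+1, 2) = ('C(n, 2) + n)%N.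
Proof. by rewrite binS bin1. Qed.

Lemma theta_expSS r s M k : theta_exp r s M.+1 k.+1 = theta_exp r s M k.
Proof. by rewrite /theta_exp !subSS. Qed.

(** Raising [M] lowers j = k - M by one, and the exponent r j(j+1)/2 + s j(j-1)/2 drops by (r + s) j
    - s. *)
Lemma theta_exp_shift r s M k :
  ((r + s) * k + theta_exp r s M.+1 k
   = theta_exp r s M k + (s + (r + s) * M))%N.
Proof.
rewrite /theta_exp; case: (leqP k M) => kM.
  have -> : (k - M.+1 = 0)%N by lia.
  have -> : (k - M = 0)%N by lia.
  by rewrite subSn // !binS2 !bin0n; nia.
have [d ->] : exists d, k = (M + d.+1)%N by exists (k - M.+1)%N; lia.
have -> : (M + d.+1 - M = d.+1)%N by lia.
have -> : (M + d.+1 - M.+1 = d)%N by lia.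
have -> : (M - (M + d.+1) = 0)%N by lia.
have -> : (M.+1 - (M + d.+1) = 0)%N by lia.
by rewrite !binS2 !bin0n; nia.
Qed.

(** The q-binomial theorem: once the factor 1 + z is split off, the remaining product is the same
    one at z Q. *)
Lemma gauss_qbin (R : comNzRingType) (Q z : R) N :
  \prod_(i < N) (1 + z * Q ^+ i)
  = \sum_(k < N.+1) qbin Q N k * (Q ^+ 'C(k, 2) * z ^+ k).
Proof.
elim: N z => [|N IHN] z.
  by rewrite big_ord0 big_ord1 qbinn0 !mul1r.
rewrite big_ord_recl expr0 mulr1.
under eq_bigr => i _ do rewrite lift0 exprS mulrA.
rewrite IHN mulrDl mul1r [RHS]big_ord_recl qbinn0 !mul1r.
under [X in _ = _ + X]eq_bigr => i _ do rewrite lift0 qbinS mulrDl.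
rewrite big_split /= [RHS]addrCA addrC mulr_sumr; congr (_ + _); last first.
  apply: eq_bigr => i _; rewrite exprMn (exprS z) binS2 exprD; ring.
have -> : z ^+ 0 + \sum_(i < N.+1) Q ^+ i.+1 * qbin Q N i.+1
                * (Q ^+ 'C(i.+1, 2) * z ^+ i.+1)
  = \sum_(i < N.+2) Q ^+ i * qbin Q N i * (Q ^+ 'C(i, 2) * z ^+ i).
  by rewrite [RHS]big_ord_recl /= qbinn0 !mul1r.
rewrite [RHS]big_ord_recr /= (qbin_small _ (ltnSn N)) mulr0 mul0r addr0.
by apply: eq_bigr => i _; rewrite exprMn; ring.
Qed.

(** Induction on [M], starting from the q-binomial theorem. The two terms of the q-Pascal rule match
    the two terms of the new factor, the second one through [theta_exp_shift]. *)
Lemma finite_jtp (R : comNzRingType) (x : R) r s N M :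
  (\prod_(i < N) (1 + x ^+ (r + (r + s) * i)))
  * (\prod_(i < M) (1 + x ^+ (s + (r + s) * i)))
  = \sum_(k < (N + M).+1)
       qbin (x ^+ (r + s)) (N + M) k * x ^+ theta_exp r s M k.
Proof.
elim: M => [|M IHM].
  rewrite big_ord0 mulr1 addn0.
  under eq_bigr => i _ do rewrite exprD exprM.
  rewrite gauss_qbin; apply: eq_bigr => k _; congr (_ * _).
  rewrite -!exprM -exprD /theta_exp subn0 !binS2 !bin0n; congr (_ ^+ _).
  nia.
rewrite big_ord_recr /= mulrA {}IHM addnS mulrDr mulr1 [RHS]big_ord_recl qbinn0.
under [X in _ = _ + X]eq_bigr => i _ do
  rewrite lift0 qbinS theta_expSS mulrDl -exprM.
rewrite big_split /= addrCA; congr (_ + _).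
rewrite mulr_suml.
have -> : 1 * x ^+ theta_exp r s M.+1 0 + \sum_(i < (N + M).+1)
            x ^+ ((r + s) * i.+1) * qbin (x ^+ (r + s)) (N + M) i.+1
              * x ^+ theta_exp r s M i
  = \sum_(k < (N + M).+2) qbin (x ^+ (r + s)) (N + M) k
       * x ^+ ((r + s) * k + theta_exp r s M.+1 k).
  rewrite [RHS]big_ord_recl qbinn0 muln0 add0n; congr (_ + _).
  apply: eq_bigr => i _; rewrite lift0 theta_expSS (exprD x (_ * _)%N); ring.
rewrite [RHS]big_ord_recr /= (qbin_small _ (ltnSn _)) mul0r addr0.
apply: eq_bigr => i _.
by rewrite theta_exp_shift (exprD x (theta_exp _ _ _ _)) mulrA.
Qed.

(** * Truncated series and the Jacobi triple product *)

Lemma geom_inv (R : comNzRingType) (x : R) L c : x ^+ L = 0 -> (0 < c)%N ->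
  (1 - x ^+ c) * (\sum_(i < L) x ^+ (i * c)) = 1.
Proof.
move=> xL c0.
under eq_bigr => i _ do rewrite mulnC exprM.
rewrite -opprB mulNr -subrX1 -exprM mulnC exprM xL.
by rewrite expr0n -leqn0 leqNgt c0 sub0r opprK.
Qed.

Lemma euler_inv (R : comNzRingType) (x : R) L c n : x ^+ L = 0 -> (0 < c)%N ->
  euler x c n * \prod_(1 <= j < n.+1) (\sum_(i < L) x ^+ (i * (c * j))) = 1.
Proof.
move=> xL c0; rewrite /euler -big_split /= big_nat big1 // => j /andP[j1 _].
by rewrite geom_inv // muln_gt0 c0.
Qed.

Lemma expr_nilpotent (R : comNzRingType) (x : R) L n :
  x ^+ L = 0 -> (L <= n)%N -> x ^+ n = 0.
Proof. by move=> xL /subnKC<-; rewrite exprD xL mul0r. Qed.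

Lemma euler_stable (R : comNzRingType) (x : R) L c n :
  x ^+ L = 0 -> (0 < c)%N -> (L <= n)%N -> euler x c n = euler x c L.
Proof.
move=> xL c0; elim: n => [|n IHn] Ln; first by move: Ln; rewrite leqn0 => /eqP->.
move: Ln; rewrite leq_eqVlt => /predU1P[->//|Ln].
by rewrite eulerS IHn // (expr_nilpotent xL) ?subr0 ?mulr1 //; nia.
Qed.

Lemma theta_exp_big r s N L k : (0 < r)%N -> (0 < s)%N ->
  (L + L <= N)%N -> (k < L)%N || (N + N < L + k)%N ->
  (L <= theta_exp r s N k)%N.
Proof.
move=> r0 s0 NL /orP[kL|kL]; rewrite /theta_exp.
  have -> : (k - N = 0)%N by lia.
  by rewrite !binS2; nia.
have -> : (N - k = 0)%N by lia.
by rewrite !binS2; nia.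
Qed.

(** Near both ends of the range the exponent reaches [L] and the terms vanish. In between, [k] and
    [N + N - k] are at least [L], so all Euler products in [qbin_euler] agree and the binomial is
    the inverse of the Euler product. *)
Lemma jtp (R : comNzRingType) (x : R) L r s N : x ^+ L = 0 ->
  (0 < r)%N -> (0 < s)%N -> (L + L <= N)%N ->
  (\prod_(i < N) (1 + x ^+ (r + (r + s) * i)))
  * (\prod_(i < N) (1 + x ^+ (s + (r + s) * i))) * euler x (r + s) L
  = \sum_(k < (N + N).+1) x ^+ theta_exp r s N k.
Proof.
move=> xL r0 s0 NL; rewrite finite_jtp mulr_suml; apply: eq_bigr => k _.
case: (boolP ((k < L)%N || (N + N < L + k)%N)) => [kL|].
  by rewrite (expr_nilpotent xL (theta_exp_big r0 s0 NL kL)) mulr0 mul0r.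
rewrite negb_or -!leqNgt => /andP[Lk kL].
have rs0 : (0 < r + s)%N by lia.
have := qbin_euler x (r + s) k (N + N - k).
rewrite subnKC; last by rewrite -ltnS.
rewrite !(euler_stable xL) //; try lia.
have := euler_inv L xL rs0.
move: (euler _ _ _) (qbin _ _ _) (\prod_(1 <= j < _) _) => e q v ev qee.
have -> : q * x ^+ theta_exp r s N k * e
          = (q * (e * e)) * v * x ^+ theta_exp r s N k.
  by rewrite -[LHS]mulr1 -ev; ring.
by rewrite qee ev mul1r.
Qed.

(** * Product identities in characteristic 2 *)

Lemma char2_opp (R : comNzRingType) (y : R) : 1 + 1 = 0 :> R -> - y = y.
Proof.
move=> R2; have -> : - y = (1 + 1) * (- y) + y by ring.
by rewrite R2 mul0r add0r.
Qed.

Lemma euler_double (R : comNzRingType) (x : R) c n : 1 + 1 = 0 :> R ->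
  euler x (2 * c) n = euler x c n ^+ 2.
Proof.
move=> R2; rewrite /euler -prodrXl; apply: eq_bigr => i _.
rewrite !(char2_opp _ R2) -mulnA mulnC exprM; set y := x ^+ _.
have -> : (1 + y) ^+ 2 = 1 + y ^+ 2 + (1 + 1) * y by ring.
by rewrite R2 mul0r addr0.
Qed.

Lemma theta_exp_scale c r s N k :
  theta_exp (c * r) (c * s) N k = (c * theta_exp r s N k)%N.
Proof. by rewrite /theta_exp [RHS]mulnDr !mulnA. Qed.

(** The factors of f_c sorted by index: 3 modulo 4, 1 modulo 4, and even. *)
Lemma prod_mod4 (R : comNzRingType) (x : R) c N : 1 + 1 = 0 :> R ->
  (\prod_(i < N) (1 + x ^+ (c * 3 + (c * 3 + c * 1) * i)))
  * (\prod_(i < N) (1 + x ^+ (c * 1 + (c * 3 + c * 1) * i)))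
  * euler x (2 * c) (2 * N) = euler x c (4 * N).
Proof.
move=> R2; elim: N => [|N IHN]; first by rewrite !big_ord0 !euler0 !mulr1.
rewrite !big_ord_recr /= (mulnS 2) (mulnS 4) !addSn !add0n !eulerS -IHN.
rewrite !(char2_opp _ R2).
have -> : (2 * c * (2 * N).+1 = c * (4 * N).+2)%N by lia.
have -> : (2 * c * (2 * N).+2 = c * (4 * N).+4)%N by lia.
have -> : (c * 3 + (c * 3 + c * 1) * N = c * (4 * N).+3)%N by lia.
have -> : (c * 1 + (c * 3 + c * 1) * N = c * (4 * N).+1)%N by lia.
by ring.
Qed.

Lemma prod_mod5 (R : comNzRingType) (x : R) N : 1 + 1 = 0 :> R ->
  (\prod_(i < N) (1 + x ^+ (1 + (1 + 4) * i)))
  * (\prod_(i < N) (1 + x ^+ (4 + (1 + 4) * i)))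
  * ((\prod_(i < N) (1 + x ^+ (2 + (2 + 3) * i)))
  * (\prod_(i < N) (1 + x ^+ (3 + (2 + 3) * i))))
  * euler x 5 N = euler x 1 (5 * N).
Proof.
move=> R2; elim: N => [|N IHN]; first by rewrite !big_ord0 !euler0 !mulr1.
rewrite !big_ord_recr /= (mulnS 5) !addSn !add0n !eulerS -IHN.
rewrite !(char2_opp _ R2) !mul1n (mulnS 5) !addSn add0n.
by ring.
Qed.

(* Modulo 2 this is Jacobi's identity for the cube of the Euler product. *)
Lemma euler_cube (R : comNzRingType) (x : R) L c N : 1 + 1 = 0 :> R ->
  x ^+ L = 0 -> (0 < c)%N -> (L + L <= N)%N ->
  euler x c L ^+ 3 = \sum_(k < (N + N).+1) x ^+ (c * theta_exp 3 1 N k).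
Proof.
move=> R2 xL c0 NL.
have c3 : (0 < c * 3)%N by lia.
have c1 : (0 < c * 1)%N by lia.
have := jtp xL c3 c1 NL.
under [X in _ = X -> _]eq_bigr => k _ do rewrite theta_exp_scale.
move=> <-.
(* Modulo 2, f_{4c} = f_{2c}^2: one f_{2c} completes the two products to f_c, the other equals
   f_c^2. *)
have -> : (c * 3 + c * 1 = 2 * (2 * c))%N by lia.
rewrite euler_double //.
have := prod_mod4 x c N R2.
rewrite (euler_stable (n := 4 * N) xL) ?(euler_stable (n := 2 * N) xL) //; try lia.
have -> : (c * 3 + c * 1 = 2 * (2 * c))%N by lia.
move=> H; rewrite expr2 mulrA H euler_double //; ring.
Qed.

(** The two triple products cover the four nonzero residues modulo 5 and bring two copies of f_5;
    one copy completes f_1, the other remains. *)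
Lemma theta5_prod (R : comNzRingType) (x : R) L N : 1 + 1 = 0 :> R ->
  x ^+ L = 0 -> (L + L <= N)%N ->
  (\sum_(k < (N + N).+1) x ^+ (theta_exp 1 4 N k))
  * (\sum_(k < (N + N).+1) x ^+ (theta_exp 2 3 N k))
  = euler x 1 L * euler x 5 L.
Proof.
move=> R2 xL NL.
rewrite -(jtp xL _ _ NL) // -(jtp xL _ _ NL) //.
have := prod_mod5 x N R2.
rewrite (euler_stable (n := 5 * N) xL) ?(euler_stable (n := N) xL) //; try lia.
have -> : (1 + 4 = 5)%N by [].
have -> : (2 + 3 = 5)%N by [].
by move=> <-; ring.
Qed.

(** * The eta quotient modulo 2 *)

(** Since f_2 = f_1^2 and f_10 = f_5^2, one f_1 cancels and f_5^5 is left in the denominator.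
    Inverses are products of truncated geometric series. *)
Lemma eta_quotient_char2 (R : comNzRingType) (x : R) m : 1 + 1 = 0 :> R ->
  x ^+ m.+1 = 0 ->
  \prod_(1 <= j < m.+1)
    ((1 - x ^+ (2 * j)) * (1 - x ^+ (5 * j)) ^+ 5
      * (\sum_(i < m.+1) x ^+ (i * j))
      * (\sum_(i < m.+1) x ^+ (10 * i * j)) ^+ 5)
  = euler x 1 m.+1
    * (\prod_(1 <= j < m.+1) (\sum_(i < m.+1) x ^+ (i * (5 * j)))) ^+ 5.
Proof.
move=> R2 xL; rewrite 3!big_split /= !prodrXl -!/(euler _ _ _).
have e1 := euler_inv m xL (isT : 0 < 1)%N.
have e5 := euler_inv m xL (isT : 0 < 5)%N.
have e10 := euler_inv m xL (isT : 0 < 10)%N.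
have -> : euler x 1 m.+1 = euler x 1 m.
  by rewrite eulerS mul1n xL subr0 mulr1.
have s1 : \prod_(1 <= j < m.+1) \sum_(i < m.+1) x ^+ (i * j)
  = \prod_(1 <= j < m.+1) \sum_(i < m.+1) x ^+ (i * (1 * j)).
  by apply: eq_bigr => j _; apply: eq_bigr => i _; rewrite mul1n.
have s10 : \prod_(1 <= j < m.+1) \sum_(i < m.+1) x ^+ (10 * i * j)
  = \prod_(1 <= j < m.+1) \sum_(i < m.+1) x ^+ (i * (10 * j)).
  by apply: eq_bigr => j _; apply: eq_bigr => i _; rewrite mulnCA mulnA.
rewrite s1 s10; move: e1 e5 e10 {s1 s10}.
rewrite (euler_double x 5 m R2) -{3}[2%N]muln1 (euler_double x 1 m R2).
move: (\prod_(1 <= j < m.+1) \sum_(i < m.+1) x ^+ (i * (1 * j))) => d1.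
move: (\prod_(1 <= j < m.+1) \sum_(i < m.+1) x ^+ (i * (5 * j))) => d5.
move: (\prod_(1 <= j < m.+1) \sum_(i < m.+1) x ^+ (i * (10 * j))) => d10.
move: (euler x 1 m) (euler x 5 m) => f g e1 e5 e10.
have d10E : d10 = d5 ^+ 2.
  have -> : d10 = d10 * (g * d5) ^+ 2 by rewrite e5 expr1n mulr1.
  have -> : d10 * (g * d5) ^+ 2 = (g ^+ 2 * d10) * d5 ^+ 2 by ring.
  by rewrite e10 mul1r.
have -> : f ^+ 2 * g ^+ 5 * d1 * d10 ^+ 5
  = f * (f * d1) * (g * d5) ^+ 5 * d5 ^+ 5 by rewrite d10E; ring.
by rewrite e1 e5; ring.
Qed.

(** With [d] = 1/g, f/g^5 is f g / g^6, and the key congruence applies to f g. *)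
Lemma eta_quotient_square (R : comNzRingType) (x f g d : R) :
  g * d = 1 -> f * g = f ^+ 6 + x * g ^+ 6 ->
  f * d ^+ 5 = x + (f ^+ 3 * d ^+ 3) ^+ 2.
Proof.
move=> gd fg.
have -> : f * d ^+ 5 = (f * g) * d ^+ 6 + (1 - g * d) * (f * d ^+ 5) by ring.
have -> : (f * g) * d ^+ 6 = x * (g * d) ^+ 6 + (f ^+ 3 * d ^+ 3) ^+ 2.
  by rewrite fg; ring.
by rewrite gd; ring.
Qed.

(** Write (f/g)^3 as (f g)^3 / g^6 and expand (a + b)^3 = a^3 + a^2 b + a b^2 + b^3 with a = f^6, b
    = x g^6. Each term is a square or [x] times a square, which separates even and odd powers. *)
Lemma eta_cube_dissection (R : comNzRingType) (x f g d : R) : 1 + 1 = 0 :> R ->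
  g * d = 1 -> f * g = f ^+ 6 + x * g ^+ 6 ->
  f ^+ 3 * d ^+ 3 = (f ^+ 9 * d ^+ 3) ^+ 2 + x * (f ^+ 6) ^+ 2
    + (x * (f ^+ 3 * g ^+ 3)) ^+ 2 + x * (x * g ^+ 6) ^+ 2.
Proof.
move=> R2 gd fg.
have -> : f ^+ 3 * d ^+ 3 = (f * d) ^+ 3 * (g * d) ^+ 3.
  by rewrite gd expr1n mulr1 exprMn.
have -> : (f * d) ^+ 3 * (g * d) ^+ 3 = (f * g) ^+ 3 * d ^+ 6 by ring.
rewrite fg.
have -> : (f ^+ 6 + x * g ^+ 6) ^+ 3 * d ^+ 6 = (f ^+ 9 * d ^+ 3) ^+ 2
   + (g * d) ^+ 6 * (x * (f ^+ 6) ^+ 2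
    + (x * (f ^+ 3 * g ^+ 3)) ^+ 2 + x * (x * g ^+ 6) ^+ 2)
   + (1 + 1) * (x * f ^+ 12 * g ^+ 6 * d ^+ 6 + x ^+ 2 * f ^+ 6 * g ^+ 12 * d ^+ 6).
  by ring.
by rewrite gd R2; ring.
Qed.

(** * Theta exponents and counting in boxes of integer pairs *)

Lemma binS2_double n : (2 * 'C(n.+1, 2) = n.+1 * n)%N.
Proof. by elim: n => // n IHn; rewrite binS2 mulnDr IHn; nia. Qed.

Lemma theta_expE r s N k (j : int) : k%:Z = N%:Z + j ->
  2%:Z * (theta_exp r s N k)%:Z
  = r%:Z * (j * j + j) + s%:Z * (j * j - j).
Proof.
rewrite /theta_exp => kE.
have [kN|Nk] := leqP k N.
  have [d dE] : exists d, (N - k)%N = d by exists (N - k)%N.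
  have -> : (k - N = 0)%N by lia.
  have -> : j = - d%:Z by lia.
  rewrite dE; have := binS2_double d; rewrite binS2 !bin0n.
  move: 'C(d, 2) => c cE; have c2 : d%:Z * d%:Z = 2 * c%:Z + d%:Z by lia.
  by rewrite !(PoszD, PoszM) mulrNN c2 /=; ring.
have [d dE] : exists d, (k - N)%N = d by exists (k - N)%N.
have -> : (N - k = 0)%N by lia.
have -> : j = d%:Z by lia.
rewrite dE; have := binS2_double d; rewrite binS2 !bin0n.
move: 'C(d, 2) => c cE; have c2 : d%:Z * d%:Z = 2 * c%:Z + d%:Z by lia.
by rewrite !(PoszD, PoszM) c2 /=; ring.
Qed.

Definition int_range (B : nat) : seq int :=
  [seq i%:Z - B%:Z | i <- iota 0 (B + B).+1].

Definition int_box (B : nat) : seq (int * int) :=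
  [seq (a, b) | a <- int_range B, b <- int_range B].

Lemma mem_int_range B a : (a \in int_range B) = (- B%:Z <= a <= B%:Z).
Proof.
apply/mapP/idP => [[i]|aB]; first by rewrite mem_iota => iB ->; lia.
by exists (absz (a + B%:Z)); rewrite ?mem_iota; lia.
Qed.

Lemma mem_int_box B z : (z \in int_box B)
  = (- B%:Z <= z.1 <= B%:Z) && (- B%:Z <= z.2 <= B%:Z).
Proof.
rewrite -!mem_int_range; case: z => a b /=.
apply/allpairsP/andP => [[[a' b'] /= [Ha Hb [-> ->]]] //|[Ha Hb]].
by exists (a, b).
Qed.

Lemma int_box_uniq B : uniq (int_box B).
Proof.
have U : uniq (int_range B) by rewrite map_inj_uniq ?iota_uniq // => i j; lia.
by apply: allpairs_uniq => // -[a b] [c d].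
Qed.

(** An inequality suffices: along a closed cycle of maps the inequalities become equalities. *)
Lemma leq_count_inj (T : eqType) (s : seq T) (P Q : pred T) (h : T -> T) :
  uniq s -> injective h -> (forall z, P z -> Q (h z)) ->
  (forall z, Q z -> z \in s) -> (count P s <= count Q s)%N.
Proof.
move=> Us hI PQ Qs; rewrite -!size_filter -(size_map h); apply: uniq_leq_size.
  by rewrite map_inj_uniq // filter_uniq.
move=> y /mapP[z]; rewrite mem_filter => /andP[/PQ Qz _] ->.
by rewrite mem_filter Qz Qs.
Qed.

Lemma card_eq_count (U : finType) (T : eqType) (s : seq T)
    (P : pred U) (Q : pred T) (h : U -> T) :
  uniq s -> injective h -> (forall u, P u -> Q (h u)) ->
  (forall z, Q z -> z \in s) -> (forall z, Q z -> exists2 u, P u & h u = z) ->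
  #|P| = count Q s.
Proof.
move=> Us hI PQ Qs QP; rewrite -size_filter cardE -(size_map h).
apply: perm_size; apply: uniq_perm.
- by rewrite map_inj_uniq // enum_uniq.
- exact: filter_uniq.
move=> z; rewrite mem_filter; apply/mapP/andP => [[u]|[Qz _]].
  by rewrite mem_enum => /PQ Qu ->; rewrite Qs.
by have [u Pu <-] := QP z Qz; exists u; rewrite ?mem_enum.
Qed.

(** * Gaussian integers with odd coordinates, up to units *)

(** Taking [c = 5] expresses norm M/5 without division. *)
Definition odd_norm (c M : int) : pred (int * int) := fun z =>
  [&& (z.1 %% 2)%Z == 1, (z.2 %% 2)%Z == 1
    & c * (z.1 * z.1 + z.2 * z.2) == M].

Definition norm_mod4 (c M i j : int) : pred (int * int) := fun z =>
  [&& (z.1 %% 4)%Z == i, (z.2 %% 4)%Z == j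
    & c * (z.1 * z.1 + z.2 * z.2) == M].

(* [z] stands for the Gaussian integer [z.1 + z.2 i], and the residue is its
   image under the map from Z[i] to F_5 sending [i] to 3. *)
Definition norm_mod5 (M v : int) : pred (int * int) := fun z =>
  odd_norm 1 M z && (((z.1 + 3 * z.2) %% 5)%Z == v).

(** Multiplication by i. *)
Definition rot (z : int * int) : int * int := (- z.2, z.1).

Lemma rot_inj : injective rot.
Proof. by move=> [a b] [c d] [] /= *; congr (_, _); lia. Qed.

Lemma norm_box (B c : nat) (z : int * int) :
  (0 < c)%N -> c%:Z * (z.1 * z.1 + z.2 * z.2) = B%:Z -> z \in int_box B.
Proof.
move=> c0 zB; rewrite mem_int_box.
case: z zB => a b /=; set u := a * a; set v := b * b => zB.
have u0 : [&& 0 <= u, a <= u & - a <= u] by rewrite /u; nia.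
have v0 : [&& 0 <= v, b <= v & - b <= v] by rewrite /v; nia.
have : u + v <= B%:Z by rewrite -zB ler_peMl //; lia.
by clearbody u v; lia.
Qed.

(** Multiplication by i permutes the residue pairs cyclically, (1,1), (3,1), (3,3), (1,3), so each
    of the four classes has the same count. *)
Lemma count_norm_mod4 (B c : nat) : (0 < c)%N ->
  count (odd_norm c%:Z B%:Z) (int_box B)
  = (4 * count (norm_mod4 c%:Z B%:Z 1 1) (int_box B))%N.
Proof.
move=> c0; set D := int_box B.
pose n i j := count (norm_mod4 c%:Z B%:Z i j) D.
have box i j z : norm_mod4 c%:Z B%:Z i j z -> z \in D.
  by case/and3P => _ _ /eqP; apply: norm_box.
have cycle i j i' : (i' = (- j %% 4)%Z) -> (n i j <= n i' i)%N.
  move=> ->; apply: (leq_count_inj (int_box_uniq B) rot_inj _ (@box _ _)).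
  move=> z /and3P[/eqP zi /eqP zj /eqP zB]; apply/and3P; split; apply/eqP => //=.
    by rewrite -zj; lia.
  by rewrite -zB; ring.
have c1 := cycle 1 1 3 erefl; have c2 := cycle 3 1 3 erefl.
have c3 := cycle 3 3 1 erefl; have c4 := cycle 1 3 1 erefl.
suff -> : count (odd_norm c%:Z B%:Z) D = (n 1 1 + n 1 3 + n 3 1 + n 3 3)%N.
  by rewrite -/(n 1 1); clear box cycle; clearbody n; move: c1 c2 c3 c4;
  move: (n 1 1) (n 1 3) (n 3 1) (n 3 3) => *; lia.
rewrite /n; elim: D {box n cycle c1 c2 c3 c4} => //= z s ->.
suff -> : odd_norm c%:Z B%:Z z = (norm_mod4 c%:Z B%:Z 1 1 z
   + norm_mod4 c%:Z B%:Z 1 3 z + norm_mod4 c%:Z B%:Z 3 1 z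
   + norm_mod4 c%:Z B%:Z 3 3 z)%N :> nat by ring.
rewrite /odd_norm /norm_mod4; case: (_ == B%:Z); rewrite ?andbF // !andbT.
lia.
Qed.

Lemma count_norm_mod5_0 (B : nat) :
  count (norm_mod5 B%:Z 0) (int_box B) = count (odd_norm 5 B%:Z) (int_box B).
Proof.
have box1 z : norm_mod5 B%:Z 0 z -> z \in int_box B.
  by case/andP => /and3P[_ _ /eqP H] _; apply: (norm_box (c := 1)).
have box5 z : odd_norm 5 B%:Z z -> z \in int_box B.
  by case/and3P=> _ _ /eqP H; apply: (norm_box (c := 5)).
(* Multiplication by 2 + i, which generates the kernel of the residue map. *)
pose h (z : int * int) : int * int := (2 * z.1 - z.2, z.1 + 2 * z.2).
have hI : injective h by move=> [a b] [c d] [] /= *; congr (_, _); lia.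
rewrite -!size_filter -(size_map h [seq x <- _ | odd_norm _ _ x]).
apply: perm_size; apply: uniq_perm.
- by rewrite filter_uniq ?int_box_uniq.
- by rewrite map_inj_uniq ?filter_uniq ?int_box_uniq.
move=> z; rewrite mem_filter; apply/andP/mapP => [[Pz _]|[w]].
  case: z Pz => a b /andP[/and3P[/eqP z1 /eqP z2 /eqP zB] /eqP zv].
  rewrite /= in z1 z2 zB zv.
  (* The preimage is z (2 - i) / 5. *)
  have [w1 E1] : exists w1 : int, 2 * a + b = 5 * w1.
    by exists ((2 * a + b) %/ 5)%Z; lia.
  have [w2 E2] : exists w2 : int, 2 * b - a = 5 * w2.
    by exists ((2 * b - a) %/ 5)%Z; lia.
  have Ea : a = 2 * w1 - w2 by lia.
  have Eb : b = w1 + 2 * w2 by lia.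
  exists (w1, w2); last by rewrite /h /= Ea Eb.
  have odd_w : odd_norm 5 B%:Z (w1, w2).
    apply/and3P; split; apply/eqP => /=; [lia|lia|].
    by rewrite -zB Ea Eb; ring.
  by rewrite mem_filter odd_w box5.
rewrite mem_filter => /andP[/and3P[/eqP w1 /eqP w2 /eqP wB] _] ->.
have Pz : norm_mod5 B%:Z 0 (h w).
  apply/andP; split; last by apply/eqP; rewrite /h /=; lia.
  apply/and3P; split; apply/eqP; rewrite /h /=; [lia|lia|].
  by rewrite -wB; ring.
by rewrite Pz box1.
Qed.

(** Multiplication by i multiplies the residue by 3, which runs through the nonzero classes as 1, 3,
    4, 2. *)
Lemma count_norm_mod5 (B : nat) :
  count (odd_norm 1 B%:Z) (int_box B)
  = (count (odd_norm 5 B%:Z) (int_box B)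
     + 4 * count (norm_mod5 B%:Z 1) (int_box B))%N.
Proof.
rewrite -count_norm_mod5_0; set D := int_box B.
pose n v := count (norm_mod5 B%:Z v) D.
have box v z : norm_mod5 B%:Z v z -> z \in D.
  by case/andP => /and3P[_ _ /eqP H] _; apply: (norm_box (c := 1)).
have cycle v v' : (v' = (3 * v %% 5)%Z) -> (n v <= n v')%N.
  move=> ->; apply: (leq_count_inj (int_box_uniq B) rot_inj _ (@box _)).
  move=> z /andP[/and3P[/eqP z1 /eqP z2 /eqP zB] /eqP zv].
  apply/andP; split; last by apply/eqP => /=; rewrite -zv; lia.
  apply/and3P; split; apply/eqP => //=; first by lia.
  by rewrite -zB; ring.
have c1 := cycle 1 3 erefl; have c2 := cycle 3 4 erefl.
have c3 := cycle 4 2 erefl; have c4 := cycle 2 1 erefl.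
suff -> : count (odd_norm 1 B%:Z) D = (n 0%Z + n 1 + n 2 + n 3 + n 4)%N.
  by rewrite -/(n 0) -/(n 1); clear box cycle; clearbody n; move: c1 c2 c3 c4;
  move: (n 0) (n 1) (n 2) (n 3) (n 4) => *; lia.
rewrite /n; elim: D {box n cycle c1 c2 c3 c4} => //= z s ->.
suff -> : odd_norm 1 B%:Z z = (norm_mod5 B%:Z 0 z
   + norm_mod5 B%:Z 1 z + norm_mod5 B%:Z 2 z
   + norm_mod5 B%:Z 3 z + norm_mod5 B%:Z 4 z)%N :> nat by ring.
rewrite /norm_mod5; case: (odd_norm 1 B%:Z z) => //=; lia.
Qed.

(** * Theta coefficients as counts of Gaussian integers *)

Lemma int_norm_sqr (a : int) : a <= a * a /\ - a <= a * a.
Proof. by split; nia. Qed.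

Lemma ord_shift N (j : int) : - N%:Z <= j <= N%:Z ->
  exists k : 'I_(N + N).+1, k%:Z = N%:Z + j.
Proof.
move=> jN; have kK : (absz (N%:Z + j)%R < (N + N).+1)%N by lia.
by exists (Ordinal kK) => /=; lia.
Qed.

Lemma theta31E N k (j : int) : k%:Z = N%:Z + j ->
  8 * (theta_exp 3 1 N k)%:Z + 1 = (4 * j + 1) * (4 * j + 1).
Proof. by move=> kE; have := theta_expE 3 1 kE; lia. Qed.

(** Completing the square sends an index pair to coordinates 4j + 1; the bound on [B] keeps every
    solution within the index range. *)
Lemma card_theta31 (c B N : nat) : (0 < c)%N -> (B <= 8 * N + 2)%N ->
  #|[pred p : 'I_(N + N).+1 * 'I_(N + N).+1 |
      c * (8 * (theta_exp 3 1 N p.1 + theta_exp 3 1 N p.2) + 2) == B]%N|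
  = count (norm_mod4 c%:Z B%:Z 1 1) (int_box B).
Proof.
move=> c0 BN.
pose h (p : 'I_(N + N).+1 * 'I_(N + N).+1) : int * int :=
  (4 * (p.1%:Z - N%:Z) + 1, 4 * (p.2%:Z - N%:Z) + 1).
have normE p : (h p).1 * (h p).1 + (h p).2 * (h p).2
  = (8 * (theta_exp 3 1 N p.1 + theta_exp 3 1 N p.2) + 2)%N%:Z.
  have := @theta31E N p.1 (p.1%:Z - N%:Z) ltac:(lia).
  have := @theta31E N p.2 (p.2%:Z - N%:Z) ltac:(lia).
  by rewrite /h /=; lia.
apply: (card_eq_count (int_box_uniq B) (h := h)).
- move=> [k l] [k' l'] [] /= kk ll.
  by congr (_, _); apply: val_inj => /=; lia.
- move=> p /eqP pB; apply/and3P; split; apply/eqP => /=; try lia.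
  by rewrite normE -pB; lia.
- by move=> z /and3P[_ _ /eqP zB]; apply: (norm_box c0).
move=> [a b] /and3P[/eqP a4 /eqP b4 /eqP zB]; rewrite /= in a4 b4 zB.
have [i aE] : exists i : int, a = 4 * i + 1 by exists (a %/ 4)%Z; lia.
have [j bE] : exists j : int, b = 4 * j + 1 by exists (b %/ 4)%Z; lia.
have [a1 a2] := int_norm_sqr a; have [b1 b2] := int_norm_sqr b.
have abB : a * a + b * b <= B%:Z by rewrite -zB ler_peMl //; lia.
have [i1 i2] := int_norm_sqr i; have [j1 j2] := int_norm_sqr j.
rewrite aE bE in abB.
have [k kE] : exists k : 'I_(N + N).+1, k%:Z = N%:Z + i.
  by apply: ord_shift; lia.
have [l lE] : exists k : 'I_(N + N).+1, k%:Z = N%:Z + j.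
  by apply: ord_shift; lia.
have hE : h (k, l) = (a, b) by rewrite /h /= kE lE aE bE; congr (_, _); lia.
exists (k, l) => //; apply/eqP.
have := normE (k, l); rewrite hE /= => E.
by rewrite E in zB; lia.
Qed.

Lemma card_theta5 (n N : nat) : (n <= N)%N ->
  #|[pred p : 'I_(N + N).+1 * 'I_(N + N).+1 |
      theta_exp 1 4 N p.1 + theta_exp 2 3 N p.2 == n]%N|
  = count (norm_mod5 (8 * n + 2)%N%:Z 1) (int_box (8 * n + 2)).
Proof.
move=> nN.
(* With w = i + j sqrt(-1) formed from the centred indices, this is 2(2 + sqrt(-1)) w - (1 +
   sqrt(-1)): exactly the numbers with odd coordinates and residue 1. *)
pose h (p : 'I_(N + N).+1 * 'I_(N + N).+1) : int * int :=
  (4 * (p.1%:Z - N%:Z) - 2 * (p.2%:Z - N%:Z) - 1,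
   2 * (p.1%:Z - N%:Z) + 4 * (p.2%:Z - N%:Z) - 1).
have normE p : (h p).1 * (h p).1 + (h p).2 * (h p).2
  = (8 * (theta_exp 1 4 N p.1 + theta_exp 2 3 N p.2) + 2)%N%:Z.
  have := @theta_expE 1 4 N p.1 (p.1%:Z - N%:Z) ltac:(lia).
  have := @theta_expE 2 3 N p.2 (p.2%:Z - N%:Z) ltac:(lia).
  by rewrite /h /=; move: (p.1%:Z - N%:Z) (p.2%:Z - N%:Z) => i j; lia.
apply: (card_eq_count (int_box_uniq _) (h := h)).
- move=> [k l] [k' l'] [] /= kk ll.
  by congr (_, _); apply: val_inj => /=; lia.
- move=> p /eqP pB; apply/andP; split; last by apply/eqP => /=; lia.
  apply/and3P; split; apply/eqP => /=; try lia.
  by rewrite mul1r normE -pB; lia.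
- move=> z /andP[/and3P[_ _ /eqP zB] _]; exact: (norm_box (c := 1)).
move=> [a b] /andP[/and3P[/eqP a2 /eqP b2 /eqP zB] /eqP zv].
rewrite /= mul1r in a2 b2 zB zv.
(* Solving for w: multiply z + 1 + sqrt(-1) by the conjugate 2 - sqrt(-1) and divide by 10. *)
have [i iE] : exists i : int, 2 * a + b + 3 = 10 * i.
  by exists ((2 * a + b + 3) %/ 10)%Z; lia.
have [j jE] : exists j : int, 2 * b - a + 1 = 10 * j.
  by exists ((2 * b - a + 1) %/ 10)%Z; lia.
have aE : a = 4 * i - 2 * j - 1 by lia.
have bE : b = 2 * i + 4 * j - 1 by lia.
have ijn : (5 * (i * i) - 3 * i) + (5 * (j * j) - j) = 2 * n%:Z.
  by rewrite aE bE in zB; lia.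
have [i1 i2] := int_norm_sqr i; have [j1 j2] := int_norm_sqr j.
have [k kE] : exists k : 'I_(N + N).+1, k%:Z = N%:Z + i.
  by apply: ord_shift; lia.
have [l lE] : exists k : 'I_(N + N).+1, k%:Z = N%:Z + j.
  by apply: ord_shift; lia.
have hE : h (k, l) = (a, b) by rewrite /h /= kE lE aE bE; congr (_, _); lia.
exists (k, l) => //; apply/eqP.
have := normE (k, l); rewrite hE /= => E.
by rewrite E in zB; lia.
Qed.

(** All three counts concern norm 8n + 2; the common factor 4 from the units cancels in
    [count_norm_mod5]. *)
Lemma card_theta_identity (n N : nat) : (n <= N)%N ->
  #|[pred p : 'I_(N + N).+1 * 'I_(N + N).+1 |
      theta_exp 3 1 N p.1 + theta_exp 3 1 N p.2 == n]%N|
  = (#|[pred p : 'I_(N + N).+1 * 'I_(N + N).+1 |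
      theta_exp 1 4 N p.1 + theta_exp 2 3 N p.2 == n]%N|
    + #|[pred p : 'I_(N + N).+1 * 'I_(N + N).+1 |
      1 + (5 * theta_exp 3 1 N p.1 + 5 * theta_exp 3 1 N p.2) == n]%N|)%N.
Proof.
move=> nN; rewrite card_theta5 //.
have BN : (8 * n + 2 <= 8 * N + 2)%N by lia.
have E1 := card_theta31 (isT : 0 < 1)%N BN.
have E5 := card_theta31 (isT : 0 < 5)%N BN.
have H1 := count_norm_mod4 (8 * n + 2) (isT : 0 < 1)%N.
have H5 := count_norm_mod4 (8 * n + 2) (isT : 0 < 5)%N.
have H := count_norm_mod5 (8 * n + 2).
have -> : #|[pred p : 'I_(N + N).+1 * 'I_(N + N).+1 |
      theta_exp 3 1 N p.1 + theta_exp 3 1 N p.2 == n]%N|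
  = count (norm_mod4 1 (8 * n + 2)%N%:Z 1 1) (int_box (8 * n + 2)).
  by rewrite -E1; apply: eq_card => p; rewrite !inE; apply/eqP/eqP; lia.
have -> : #|[pred p : 'I_(N + N).+1 * 'I_(N + N).+1 |
      1 + (5 * theta_exp 3 1 N p.1 + 5 * theta_exp 3 1 N p.2) == n]%N|
  = count (norm_mod4 5 (8 * n + 2)%N%:Z 1 1) (int_box (8 * n + 2)).
  by rewrite -E5; apply: eq_card => p; rewrite !inE; apply/eqP/eqP; lia.
move: (count (norm_mod4 _ _ _ _) _) (count (norm_mod4 _ _ _ _) _)
  (count (norm_mod5 _ _) _) H1 H5 H => u v w; rewrite /= => -> -> H; lia.
Qed.

(** * The theta identity and the key congruence *)

Lemma sum_expr_card (R : comNzRingType) (x : R) L (I : finType) (h : I -> nat) :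
  x ^+ L = 0 ->
  \sum_i x ^+ h i = \sum_(n < L) x ^+ n *+ #|[pred i | h i == n]|.
Proof.
move=> xL.
transitivity (\sum_i \sum_(n < L | h i == n) x ^+ n).
  apply: eq_bigr => i _; case: (ltnP (h i) L) => hL.
    rewrite (bigD1 (Ordinal hL)) //= big1 ?addr0 // => n /andP[/eqP hn].
    by case/eqP; apply: val_inj.
  rewrite big1 ?(expr_nilpotent xL) // => n /eqP hn.
  by move: (ltn_ord n); rewrite -hn ltnNge hL.
rewrite (exchange_big_dep xpredT) //=; apply: eq_bigr => n _.
by rewrite sumr_const.
Qed.

Lemma theta_identity (R : comNzRingType) (x : R) L N : x ^+ L = 0 ->
  (L <= N)%N ->
  (\sum_(k < (N + N).+1) x ^+ theta_exp 3 1 N k) ^+ 2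
  = (\sum_(k < (N + N).+1) x ^+ theta_exp 1 4 N k)
    * (\sum_(k < (N + N).+1) x ^+ theta_exp 2 3 N k)
  + x * (\sum_(k < (N + N).+1) x ^+ (5 * theta_exp 3 1 N k)) ^+ 2.
Proof.
move=> xL LN.
have prodE (h g : 'I_(N + N).+1 -> nat) :
  (\sum_k x ^+ h k) * (\sum_k x ^+ g k) = \sum_p x ^+ (h p.1 + g p.2).
  rewrite big_distrlr /= pair_big; apply: eq_bigr => p _.
  by rewrite exprD.
rewrite !expr2 !prodE mulr_sumr.
under [X in _ = _ + X]eq_bigr => p _ do rewrite -exprS -add1n.
rewrite !(sum_expr_card _ xL) -big_split /=; apply: eq_bigr => n _.
by rewrite card_theta_identity ?mulrnDr // ltnW // (leq_trans (ltn_ord n)).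
Qed.

(** By [euler_cube] the sixth powers are psi(q)^2 and psi(q^5)^2; in characteristic 2 the term q
    psi(q^5)^2 changes sides freely. *)
Lemma euler_1_5 (R : comNzRingType) (x : R) L : 1 + 1 = 0 :> R ->
  x ^+ L = 0 ->
  euler x 1 L * euler x 5 L = euler x 1 L ^+ 6 + x * euler x 5 L ^+ 6.
Proof.
move=> R2 xL.
have NL : (L + L <= L + L)%N by [].
have LN : (L <= L + L)%N by lia.
rewrite -(theta5_prod R2 xL NL) (exprM _ 3 2) (exprM (euler x 5 L) 3 2).
rewrite !(euler_cube R2 xL _ NL) //.
under [X in _ = X ^+ 2 + _]eq_bigr => k _ do rewrite mul1n.
rewrite (theta_identity xL LN) -addrA.
set y := x * _.
by have -> : y + y = (1 + 1) * y; [ring | rewrite R2 mul0r addr0].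
Qed.

(** * Transfer to polynomials over F_2 *)

Lemma rmorph_euler (R S : comNzRingType) (phi : {rmorphism R -> S}) x c n :
  phi (euler x c n) = euler (phi x) c n.
Proof.
rewrite /euler rmorph_prod; apply: eq_bigr => i _.
by rewrite rmorphB rmorph1 rmorphXn.
Qed.

Lemma rmorph_eta_trunc (R : comNzRingType) (phi : {rmorphism {poly int} -> R})
    x m :
  phi 'X = x ->
  phi (eta_trunc m) = \prod_(1 <= j < m.+1)
    ((1 - x ^+ (2 * j)) * (1 - x ^+ (5 * j)) ^+ 5
      * (\sum_(i < m.+1) x ^+ (i * j))
      * (\sum_(i < m.+1) x ^+ (10 * i * j)) ^+ 5).
Proof.
move=> phiX; rewrite rmorph_prod; apply: eq_bigr => j _.
have phiXn k : phi 'X^k = x ^+ k by rewrite rmorphXn phiX.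
have phi_sum (h : 'I_m.+1 -> nat) :
  phi (\sum_i 'X^(h i)) = \sum_i x ^+ h i.
  by rewrite rmorph_sum; apply: eq_bigr => i _.
by rewrite 3!rmorphM 2!(rmorphXn phi 5) 2!rmorphB rmorph1 !phiXn !phi_sum.
Qed.

Lemma in_qpolyXn_coef (R : comNzRingType) m (p q : {poly R}) i :
  in_qpoly 'X^(m.+1) p = in_qpoly 'X^(m.+1) q -> (i <= m)%N -> p`_i = q`_i.
Proof.
move=> /(congr1 val) /=; rewrite mk_monic_Xn /= => pq im.
have E (r : {poly R}) : r`_i = (Pdiv.CommonRing.rmodp r 'X^(m.+1))`_i.
  rewrite {1}(Pdiv.RingMonic.rdivp_eq (monicXn R m.+1) r).
  by rewrite coefD coefMXn ltnS im add0r.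
by rewrite E pq -E.
Qed.

Lemma F2_addrr (y : {poly 'F_2}) : y + y = 0.
Proof.
have -> : y + y = (1 + 1)%:P * y by rewrite polyCD; ring.
have -> : (1 + 1 : 'F_2) = 0 by apply: val_inj.
by rewrite mul0r.
Qed.

Lemma F2_sqrD (y z : {poly 'F_2}) : (y + z) ^+ 2 = y ^+ 2 + z ^+ 2.
Proof. by rewrite sqrrD mulr2n F2_addrr addr0. Qed.

(** Frobenius: p(X)^2 = p(X^2) over F_2. *)
Lemma F2_sqr_coef (p : {poly 'F_2}) i :
  (p ^+ 2)`_(2 * i) = p`_i /\ (p ^+ 2)`_(2 * i).+1 = 0.
Proof.
elim/poly_ind: p i => [|p c IHp] i; first by rewrite expr0n /= !coef0.
have c2 : c ^+ 2 = c.
  by case: c => [[|[|c]] cP]; apply: val_inj.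
rewrite F2_sqrD -polyC_exp c2 exprMn mulrC !coefD !coefC coefXnM coefMX coefXnM.
case: i => [|i] /=; first by rewrite addr0.
have -> : (2 * i.+1 - 2 = 2 * i)%N by lia.
have -> : ((2 * i.+1).+1 - 2 = (2 * i).+1)%N by lia.
have -> : (2 * i.+1 < 2)%N = false by lia.
by have [-> ->] := IHp i; rewrite !addr0.
Qed.

Lemma F2_sqr_sumX (I : finType) (h : I -> nat) :
  (\sum_i 'X^(h i) : {poly 'F_2}) ^+ 2 = \sum_i 'X^(2 * h i).
Proof.
rewrite (big_morph (fun y => y ^+ 2) F2_sqrD (expr0n _ 2)).
by apply: eq_bigr => i _; rewrite -exprM mulnC.
Qed.

(** * Squares and the parity of the coefficients *)

Definition scaled_square (c M : nat) : bool :=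
  [exists b : 'I_M.+1, c * (b * b) == M]%N.

Lemma scaled_squareP c M :
  (0 < c)%N -> reflect (exists b, c * (b * b) = M)%N (scaled_square c M).
Proof.
move=> c0; apply: (iffP existsP) => [[b /eqP <-]|[b bM]]; first by exists b.
have bM' : (b < M.+1)%N by nia.
by exists (Ordinal bM'); apply/eqP.
Qed.

(** Every odd square is (4j + 1)^2 for exactly one integer j, the sign of the root being fixed
    modulo 4; so at most one term is nonzero. *)
Lemma count_scaled_square (R : comNzRingType) c M N : (0 < c)%N -> odd M ->
  (M <= 8 * N)%N ->
  \sum_(k < (N + N).+1) (M == c * (8 * theta_exp 3 1 N k + 1))%N%:R
  = (scaled_square c M)%:R :> R.
Proof.
move=> c0 Modd MN.
have eE (k : nat) : (8 * theta_exp 3 1 N k + 1)%N%:Z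
    = (4 * (k%:Z - N%:Z) + 1) * (4 * (k%:Z - N%:Z) + 1).
  by rewrite -(@theta31E N k) //; lia.
have [[b bM]|noM] := scaled_squareP M c0; last first.
  rewrite big1 // => k _; case: eqP => // Mk; case: noM.
  exists (absz (4 * (k%:Z - N%:Z) + 1)); rewrite Mk.
  by congr (c * _)%N; apply/eqP; rewrite -eqz_nat eE; apply/eqP; lia.
have bodd : odd b by move: Modd; rewrite -bM !oddM; case: (odd b); rewrite ?andbF.
have [j jE] : exists j : int, (4 * j + 1) * (4 * j + 1) = (b * b)%N%:Z.
  case: (boolP (b %% 4 == 1)%N) => b4.
    have [i ->] : exists i, b = (4 * i + 1)%N by exists (b %/ 4)%N; lia.
    by exists i%:Z; lia.
  have [i ->] : exists i, b = (4 * i + 3)%N by exists (b %/ 4)%N; lia.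
  by exists (- i%:Z - 1); lia.
have bN : (b * b <= 8 * N)%N by nia.
have [j1 j2] := int_norm_sqr j.
have [k kE] : exists k : 'I_(N + N).+1, k%:Z = N%:Z + j.
  by apply: ord_shift; lia.
have kj : k%:Z - N%:Z = j by lia.
have ek : (8 * theta_exp 3 1 N k + 1 = b * b)%N.
  by apply/eqP; rewrite -eqz_nat eE kj jE.
rewrite (bigD1 k) //= ek bM eqxx big1 ?addr0 // => l lk.
case: eqP => // Ml; case/eqP: lk; apply: val_inj => /=.
have el : (8 * theta_exp 3 1 N l + 1 = b * b)%N.
  by apply/eqP; rewrite -(eqn_pmul2l c0) bM -Ml.
have := eE l; rewrite el -jE.
have [t tE] : exists t : int, l%:Z - N%:Z = t by exists (l%:Z - N%:Z).
rewrite tE => H.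
(* This is the difference of the two squares divided by 8; its second factor is odd, hence
   nonzero. *)
have : (j - t) * (2 * (j + t) + 1) = 0 by lia.
move/eqP; rewrite mulf_eq0 => /orP[/eqP|/eqP]; lia.
Qed.

Lemma J10_mod2 u : (J10 (4 * u + 1))%:~R
  = (scaled_square 1 (4 * u + 1))%:R + (scaled_square 5 (4 * u + 1))%:R
  :> 'F_2.
Proof.
(* The factor 1/q shifts the index by one, and the constant -1 only affects index 0. *)
have -> : J10 (4 * u + 1) = (eta_trunc (4 * u + 2))`_(4 * u + 2).
  rewrite /J10 /F_coef -addnS; have -> : ((4 * u + 1)%N == 0%N) = false by lia.
  by rewrite subr0.
have [m mE] : exists m, (4 * u + 2)%N = m by exists (4 * u + 2)%N.
rewrite mE -(coef_map (intr : {rmorphism int -> 'F_2})).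
pose f : {poly 'F_2} := euler 'X 1 m.+1.
pose g : {poly 'F_2} := euler 'X 5 m.+1.
pose d : {poly 'F_2} :=
  \prod_(1 <= j < m.+1) (\sum_(i < m.+1) 'X^(i * (5 * j))).
(* In this quotient the image of ['X] is nilpotent, and coefficients up to degree [m] survive. *)
pose A := {poly %/ ('X^(m.+1) : {poly 'F_2})}.
pose pi : {rmorphism {poly 'F_2} -> A} := in_qpoly 'X^(m.+1).
pose x : A := pi 'X.
have piP p q i : pi p = pi q -> (i <= m)%N -> p`_i = q`_i.
  exact: in_qpolyXn_coef.
have R2 : 1 + 1 = 0 :> A by rewrite -(rmorph1 pi) -rmorphD F2_addrr rmorph0.
have xL : x ^+ m.+1 = 0.
  rewrite -rmorphXn; apply: val_inj.
  by rewrite /= mk_monic_Xn /= Pdiv.RingMonic.rmodpp ?monicXn.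
have pif : pi f = euler x 1 m.+1 by rewrite rmorph_euler.
have pig : pi g = euler x 5 m.+1 by rewrite rmorph_euler.
have pid : pi d
  = \prod_(1 <= j < m.+1) (\sum_(i < m.+1) x ^+ (i * (5 * j))).
  rewrite rmorph_prod; apply: eq_bigr => j _.
  by rewrite rmorph_sum; apply: eq_bigr => i _; rewrite rmorphXn.
have gd : pi g * pi d = 1.
  rewrite pig pid eulerS (expr_nilpotent xL) ?subr0 ?mulr1 ?(euler_inv m xL) //; lia.
have fg : pi f * pi g = pi f ^+ 6 + x * pi g ^+ 6.
  by rewrite pif pig euler_1_5.
have F1 : (map_poly intr (eta_trunc m))`_m = ('X + (f ^+ 3 * d ^+ 3) ^+ 2)`_m.
  apply: piP => //.
  rewrite rmorphD (rmorphXn pi 2) rmorphM !(rmorphXn pi) -/x.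
  rewrite -(eta_quotient_square gd fg) pif pid -(eta_quotient_char2 R2 xL).
  pose phi : {rmorphism {poly int} -> A} := pi \o map_poly intr.
  exact: (@rmorph_eta_trunc A phi x m (congr1 pi (map_polyX _))).
have F2 : (f ^+ 3 * d ^+ 3)`_(2 * u).+1
  = ((f ^+ 9 * d ^+ 3) ^+ 2 + 'X * (f ^+ 6) ^+ 2
    + ('X * (f ^+ 3 * g ^+ 3)) ^+ 2 + 'X * ('X * g ^+ 6) ^+ 2)`_(2 * u).+1.
  apply: piP; last by lia.
  by rewrite !(rmorphM, rmorphXn, rmorphD) (eta_cube_dissection R2 gd fg).
pose N := (m.+1 + m.+1)%N.
have NL : (m.+1 + m.+1 <= N)%N by [].
have F3 : (f ^+ 6 + 'X * g ^+ 6)`_u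
  = ((\sum_(k < (N + N).+1) 'X^(1 * theta_exp 3 1 N k)) ^+ 2
     + 'X * (\sum_(k < (N + N).+1) 'X^(5 * theta_exp 3 1 N k)) ^+ 2)`_u.
  apply: piP; last by lia.
  rewrite 2!(rmorphD pi) 2!(rmorphM pi 'X) !(rmorphXn pi) !rmorph_sum pif pig.
  rewrite (exprM _ 3 2) (exprM (euler x 5 _) 3 2) !(euler_cube R2 xL _ NL) //.
  by congr (_ ^+ 2 + _ * _ ^+ 2); apply: eq_bigr => k _; rewrite rmorphXn.
rewrite F1 coefD coefX.
(* Coefficient 2(2u + 1) of a square is coefficient 2u + 1 of its root. In the dissection only the
   odd part contributes there, and halving again leads to coefficient [u]. *)
have -> : m = (2 * (2 * u).+1)%N by lia.
have -> : (2 * (2 * u).+1 == 1)%N = false by lia.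
rewrite (F2_sqr_coef _ _).1 add0r F2 !coefD !coefXM /=.
rewrite !(F2_sqr_coef _ _).1 !(F2_sqr_coef _ _).2 add0r addr0.
rewrite -coefD F3 !F2_sqr_sumX mulr_sumr coefD !coef_sum.
(* With e a theta exponent, 2e = u means 4u + 1 = 8e + 1, and 1 + 10e = u means 4u + 1 = 5(8e +
   1). *)
rewrite -(count_scaled_square _ (N := N)) //; try lia.
rewrite -(count_scaled_square _ (N := N)) //; try lia.
by congr (_ + _); apply: eq_bigr => k _; rewrite -?exprS coefXn;
  congr (nat_of_bool _)%:R; apply/eqP/eqP; lia.
Qed.

(** * Removing the factor p^2 *)

Lemma scaled_square_prime c p M : (0 < c)%N -> prime p -> ~~ (p %| c)%N ->
  scaled_square c (p * p * M) = scaled_square c M.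
Proof.
move=> c0 pp pc; have p0 := prime_gt0 pp.
apply/(scaled_squareP _ c0)/(scaled_squareP _ c0) => -[b bM].
  have : (p %| c * (b * b))%N by rewrite bM -mulnA dvdn_mulr.
  rewrite !Euclid_dvdM // (negPf pc) orbb /= => /dvdnP[b' bE].
  exists b'; apply/eqP; rewrite -(@eqn_pmul2l (p * p)) ?muln_gt0 ?p0 //.
  by rewrite -bM bE; apply/eqP; ring.
by exists (p * b)%N; rewrite -bM; ring.
Qed.

Theorem theorem4p3 (k n p delta : nat) :
  (0 < k)%N -> prime p -> (p %% 4 = 3)%N -> (p %| 4 * delta + 3)%N ->
  (J10 (p * (4 * p ^ k * n + 4 * delta + 3))
   = J10 (4 * p ^ (k - 1) * n + (4 * delta + 3) %/ p) %[mod 2])%Z.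
Proof.
case: k => // k _ pp p4 /dvdnP[q qE].
rewrite -addnA qE mulnK ?prime_gt0 // subn1 /=.
have q4 : (q %% 4 = 1)%N.
  have : (q * p %% 4 = 3)%N by rewrite -qE; lia.
  by rewrite -modnMm p4; move: (ltn_pmod q (isT : 0 < 4)%N);
     case: (q %% 4)%N => [|[|[|[|]]]].
have [v vE] : exists v, (4 * p ^ k * n + q = 4 * v + 1)%N.
  by exists (p ^ k * n + q %/ 4)%N; lia.
have [a aE] : exists a, p = (4 * a + 3)%N by exists (p %/ 4)%N; lia.
(* This is N_1 = p^2 N_2, where N_2 = 4v + 1. *)
have E : (p * (4 * p ^ k.+1 * n + q * p) = p * p * (4 * v + 1))%N.
  by rewrite -vE expnS; ring.
(* As p = 4a + 3, p^2 = 4(4a^2 + 6a + 2) + 1, so N_1 is also 1 modulo 4. *)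
have [w wE] : exists w, (p * p * (4 * v + 1) = 4 * w + 1)%N.
  exists ((4 * a * a + 6 * a + 2) * (4 * v + 1) + v)%N; rewrite aE; ring.
have p1 : ~~ (p %| 1)%N by rewrite dvdn1; lia.
have p5 : ~~ (p %| 5)%N by rewrite dvdn_prime2 //; lia.
rewrite E vE; apply/eqP; rewrite eqz_mod_dvd.
rewrite (dvdz_pcharf (pchar_Fp (isT : prime 2))) rmorphB /= subr_eq0; apply/eqP.
by rewrite wE !J10_mod2 -wE !scaled_square_prime.
Qed.
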